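(* Let $A\in\mathbb{R}^{n\times n}$ be a symmetric $M$-matrix, and let $\mathcal{T}_d(-A\log(A))$ be the probing approximation of $S(A)$ induced by a distance-$d$ coloring of $\mathcal{G}(A)$ with $d\geq 1$. Then $$\mathcal{T}_d(-A\log(A))\leq S(A).$$
   Context: A symmetric $M$-matrix is a symmetric matrix that can be written as $A=\theta I-B$ with $\theta>0$ and $B$ an entrywise nonnegative matrix such that $\lambda\leq\theta$ for all $\lambda\in\sigma(B)$ (so $A$ is positive semidefinite, possibly singular). For a symmetric matrix $A=U\Lambda U^T$ ($U$ orthogonal, $\Lambda=\mathrm{diag}(\lambda_1,\dots,\lambda_n)$) and a function $f$ defined on the eigenvalues, $f(A)=U\,\mathrm{diag}(f(\lambda_1),\dots,f(\lambda_n))\,U^T$. Here $-A\log(A)$ means $f(A)$ with $f(x)=-x\log x$ (natural logarithm, $0\cdot\log 0=0$), and $S(A)=\mathrm{tr}(-A\log A)=-\sum_{i=1}^n\lambda_i\log\lambda_i$. The graph $\mathcal{G}(A)$ has nodes $\{1,\dots,n\}$ and edges $\{(i,j): [A]_{ij}\neq 0,\ i\neq j\}$. The geodesic distance $\mathrm{d}(i,j)$ is the shortest length (number of edges) of a walk in $\mathcal{G}(A)$ from $i$ to $j$; it is $\infty$ if no such walk exists and $0$ if $i=j$. A coloring is a partition $V_1,\dots,V_s$ of $\{1,\dots,n\}$; it is a distance-$d$ coloring ($d$ an integer) if any two distinct nodes $i\ne j$ with $\mathrm{d}(i,j)\leq d$ belong to different sets of the partition. Its probing vectors are $\boldsymbol{v}_\ell=\sum_{i\in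 V_\ell}\boldsymbol{e}_i\in\mathbb{R}^n$, $\ell=1,\dots,s$, with $\boldsymbol{e}_i$ the canonical basis vectors, and the induced probing approximation of $\mathrm{tr}(f(A))$ is $$\mathcal{T}_d(f(A))=\sum_{\ell=1}^s\boldsymbol{v}_\ell^Tf(A)\boldsymbol{v}_\ell.$$ *)

(* Defs.v *)
From HB Require Import structures.
From mathcomp Require Import all_boot all_order all_algebra.
From mathcomp Require Import ring.
From mathcomp Require complex.
From mathcomp Require Import all_classical all_reals all_analysis.

Set Implicit Arguments.
Unset Strict Implicit.
Unset Printing Implicit Defensive.

Import Order.TTheory GRing.Theory Num.Theory.

Local Open Scope ring_scope.

Section MatrixFunction.
Variable R : realType.

Definition orthogonal_mx n (U : 'M[R]_n) : Prop := U^T *m U = 1%:M.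

Definition spectral_decomposition n (A U : 'M[R]_n) (lam : 'rV[R]_n) : Prop :=
  orthogonal_mx U /\ A = U *m diag_mx lam *m U^T.

(* The value does not depend on the chosen decomposition (matfunE), and every
   symmetric matrix has one (spectral_theorem). *)
Definition matfun n (f : R -> R) (A : 'M[R]_n) : 'M[R]_n :=
  xget 0 [set F | exists U lam, spectral_decomposition A U lam /\
                    F = U *m diag_mx (map_mx f lam) *m U^T]%classic.

(* ln is total with ln 0 = 0, and the factor x gives the value 0 at 0. *)
Definition neg_xlogx (x : R) : R := - (x * ln x).

Definition entropy n (A : 'M[R]_n) : R := \tr (matfun neg_xlogx A).

(* B inherits the symmetry of A, so sigma(B) is real and consists of the
   eigenvalues of B in R. *)
Definition symmetric_Mmatrix n (A : 'M[R]_n) : Prop :=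
  A^T = A /\
  exists (theta : R) (B : 'M[R]_n),
    [/\ 0 < theta,
        forall i j, 0 <= B i j,
        forall l, eigenvalue B l -> l <= theta
      & A = theta%:M - B].

End MatrixFunction.

Section Graph.
Variable R : realType.

Definition mxedge n (A : 'M[R]_n) : rel 'I_n :=
  fun i j => (i != j) && (A i j != 0).

(* The vertices of the walk are i :: p; its length is size p. *)
Definition is_walk n (A : 'M[R]_n) (i j : 'I_n) (p : seq 'I_n) : bool :=
  path (mxedge A) i p && (last i p == j).

(* The infimum of the empty set is +oo. *)
Definition geodist n (A : 'M[R]_n) (i j : 'I_n) : \bar R :=
  ereal_inf [set (size p)%:R%:E | p in [set p : seq 'I_n | is_walk A i j p]]%classic.

Definition coloring n (P : {set {set 'I_n}}) : Prop :=
  finset.partition P [set: 'I_n]%SET.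

Definition distance_coloring n (A : 'M[R]_n) (d : nat) (P : {set {set 'I_n}}) :
    Prop :=
  coloring P /\
  forall i j : 'I_n, i != j -> (geodist A i j <= d%:R%:E)%E ->
    finset.pblock P i != finset.pblock P j.

Definition probing_vector n (V : {set 'I_n}) : 'cV[R]_n :=
  \sum_(i in V) delta_mx i 0.

Definition probing_trace n (P : {set {set 'I_n}}) (F : 'M[R]_n) : R :=
  \sum_(V in P) ((probing_vector V)^T *m F *m probing_vector V) 0 0.

End Graph.

Section MatrixFunctionTheory.
Import complex.
Variable R : realType.

Lemma spectral_decomposition_fun n (f : R -> R) (A U W : 'M[R]_n) lam mu :
  spectral_decomposition A U lam -> spectral_decomposition A W mu ->
  U *m diag_mx (map_mx f lam) *m U^T = W *m diag_mx (map_mx f mu) *m W^T.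
Proof.
move=> [oU AU] [oW AW].
have oU' : U *m U^T = 1%:M by exact: mulmx1C.
have oW' : W *m W^T = 1%:M by exact: mulmx1C.
pose Z := U^T *m W.
have h : diag_mx lam *m Z = Z *m diag_mx mu.
  have: U^T *m A *m W = U^T *m A *m W by [].
  rewrite {1}AU AW !mulmxA oU mul1mx => h.
  by rewrite h -!mulmxA oW mulmx1.
have hf : diag_mx (map_mx f lam) *m Z = Z *m diag_mx (map_mx f mu).
  apply/matrixP => i j; move/matrixP/(_ i j): h.
  rewrite !mul_diag_mx !mul_mx_diag !mxE.
  set z := \sum_k _ => h.
  have [->|z0] := eqVneq z 0; first by rewrite mulr0 mul0r.
  have -> : lam 0 i = mu 0 j by apply: (mulIf z0); rewrite h mulrC.
  by rewrite mulrC.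
have -> : U *m diag_mx (map_mx f lam) *m U^T =
          U *m (diag_mx (map_mx f lam) *m Z) *m W^T.
  by rewrite /Z -!mulmxA oW' mulmx1.
by rewrite hf /Z !mulmxA oU' mul1mx.
Qed.

Lemma matfunE n (f : R -> R) (A U : 'M[R]_n) lam :
  spectral_decomposition A U lam ->
  matfun f A = U *m diag_mx (map_mx f lam) *m U^T.
Proof.
move=> AU; apply: xget_unique; first by exists U, lam.
by move=> _ [W [mu [AW ->]]]; exact: spectral_decomposition_fun AW AU.
Qed.

Lemma entropyE n (A U : 'M[R]_n) lam : spectral_decomposition A U lam ->
  entropy A = - \sum_i lam 0 i * ln (lam 0 i).
Proof.
move=> AU; rewrite /entropy (matfunE _ AU) mxtrace_mulC mulmxA AU.1 mul1mx.
rewrite mxtrace_diag -sumrN.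
by apply: eq_bigr => i _; rewrite mxE.
Qed.

Lemma symmetric_eigenvalue n (A : 'M[R]_n.+1) :
  A^T = A -> exists a, eigenvalue A a.
Proof.
move=> sA; pose K : rcfType := R; pose C : numClosedFieldType := complex.complex K.
pose phi : {rmorphism K -> C} := complex.real_complex K.
pose AC : 'M[C]_n.+1 := map_mx phi A.
have hA : AC \is hermsymmx.
  apply: realsym_hermsym.
    by apply/is_hermitianmxP; rewrite expr0 scale1r map_mx_id // /AC map_trmx sA.
  by apply/mxOverP => i j; rewrite mxE complex.complex_real.
have /mxOverP/(_ 0 0) := hermitian_spectral_diag_real hA.
have /hermitian_normalmx/orthomx_spectralP := hA.
set P := spectralmx AC; set D := spectral_diag AC => AE Dreal.
have Pu : P \in unitmx by exact: spectral_unit.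
have /complex.complex_realP [a Da] := Dreal.
exists a; rewrite -(eigenvalue_map phi); apply/eigenvalueP.
exists (row 0 P).
  rewrite -/AC -row_mul AE !mulmxA mulmxV // mul1mx row_mul row_diag_mx.
  by rewrite -scalemxAl -rowE Da.
apply: contraL Pu => /eqP P0; rewrite unitmxE.
by rewrite (expand_det_row _ 0) big1 ?unitr0// => j _;
  move/rowP/(_ j): P0; rewrite !mxE => ->; rewrite mul0r.
Qed.

Lemma mulmx_tr_row n (v : 'rV[R]_n) : v *m v^T = (\sum_j v 0 j ^+ 2)%:M.
Proof.
apply/matrixP => i j; rewrite !ord1 !mxE eqxx mulr1n.
by apply: eq_bigr => k _; rewrite !mxE expr2.
Qed.

Lemma unit_eigenvector n (A : 'M[R]_n.+1) : A^T = A ->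
  exists a (v : 'rV[R]_n.+1), v *m v^T = 1%:M /\ v *m A = a *: v.
Proof.
move=> /symmetric_eigenvalue [a /eigenvalueP [v vA v0]].
pose c := \sum_j v 0 j ^+ 2.
have c0 : 0 < c.
  rewrite lt0r sumr_ge0 ?andbT => [|j _]; last exact: sqr_ge0.
  apply: contra v0 => /eqP c0; apply/eqP/rowP => j; rewrite mxE.
  apply/eqP; rewrite -sqrf_eq0.
  by move/psumr_eq0P: c0 => ->// i _; exact: sqr_ge0.
exists a, ((Num.sqrt c)^-1 *: v); split; last first.
  by rewrite -scalemxAl vA !scalerA mulrC.
rewrite linearZ /= -scalemxAl -scalemxAr mulmx_tr_row -/c scalerA scale_scalar_mx.
by congr (_%:M); rewrite -invfM -expr2 sqr_sqrtr ?ltW// mulVf ?gt_eqF.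
Qed.

Lemma householder n (v : 'rV[R]_n.+1) : v *m v^T = 1%:M ->
  exists H : 'M[R]_n.+1,
    [/\ H^T = H, H *m H = 1%:M & (delta_mx 0 0 : 'rV_n.+1) *m H = v].
Proof.
move=> vv; pose e : 'rV[R]_n.+1 := delta_mx 0 0; rewrite -/e.
have [<-|ve] := eqVneq e v.
  by exists 1%:M; rewrite trmx1 !mulmx1.
have ee : e *m e^T = 1%:M.
  by rewrite /e trmx_delta mul_delta_mx; apply/matrixP => i j;
    rewrite !ord1 !mxE !eqxx.
have ev : e *m v^T = (v 0 0)%:M.
  by rewrite -rowE; apply/matrixP => i j; rewrite !ord1 !mxE eqxx.
have v_e : v *m e^T = (v 0 0)%:M.
  by rewrite -[LHS]trmxK trmx_mul trmxK ev tr_scalar_mx.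
pose w := v - e; pose c := 2 - 2 * v 0 0.
have ww : w *m w^T = c%:M.
  rewrite /w linearB /= mulmxBl !mulmxBr vv ee ev v_e.
  by apply/matrixP => i j; rewrite !ord1 !mxE !eqxx /c /=; ring.
have c0 : c != 0.
  apply: contra ve => /eqP c0; rewrite eq_sym -subr_eq0 -/w.
  have : \sum_j w 0 j ^+ 2 = 0.
    move: ww; rewrite mulmx_tr_row c0 => /matrixP/(_ 0 0).
    by rewrite [LHS]mxE [RHS]mxE eqxx !mulr1n.
  move/psumr_eq0P => w0; apply/eqP/rowP => j; rewrite [RHS]mxE.
  by apply/eqP; rewrite -sqrf_eq0 w0// => i _; exact: sqr_ge0.
have ew : e *m w^T = (v 0 0 - 1)%:M.
  by rewrite /w linearB /= mulmxBr ee ev raddfB.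
have wE : w + e = v by rewrite /w subrK.
clearbody w.
exists (1%:M - (2 / c) *: (w^T *m w)); split.
- by rewrite [LHS]linearB [X in _ - X]linearZ /= trmx_mul trmxK trmx1.
- rewrite mulmxBl mul1mx mulmxBr mulmx1 -scalemxAl -scalemxAr.
  have -> : w^T *m w *m (w^T *m w) = c *: (w^T *m w).
    by rewrite -mulmxA [w *m _]mulmxA ww mul_scalar_mx -scalemxAr.
  rewrite !scalerA -addrA -!opprD -scalerBl -scalerDl.
  have -> : 2 / c + (2 / c - 2 / c * (2 / c) * c) = 0 by field.
  by rewrite scale0r subr0.
- rewrite mulmxBr mulmx1 -scalemxAr mulmxA ew mul_scalar_mx scalerA.
  have -> : 2 / c * (v 0 0 - 1) = -1 by move: c0; rewrite /c => ?; field.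
  by rewrite scaleN1r opprK addrC.
Qed.

Lemma symmetric_block n (B : 'M[R]_(1 + n)) a :
  B^T = B -> row 0 B = a *: delta_mx 0 0 ->
  B = block_mx a%:M 0 0 (drsubmx B).
Proof.
move=> sB rB.
have h j : B 0 j = a * (j == 0)%:R by move/rowP/(_ j): rB; rewrite !mxE.
have l0 : lshift n (0 : 'I_1) = 0 by exact: val_inj.
rewrite -[LHS]submxK; congr block_mx; apply/matrixP => i j; rewrite !ord1 !mxE.
- by rewrite l0 h eqxx mulr1.
- by rewrite l0 h mulr0.
- by rewrite l0 -sB mxE h mulr0.
Qed.

Theorem spectral_theorem n (A : 'M[R]_n) : A^T = A ->
  exists U lam, spectral_decomposition A U lam.
Proof.
elim: n A => [|n IH] A sA.
  by exists 1%:M, 0; split; apply/matrixP => -[].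
have [a [v [vv vA]]] := unit_eigenvector sA.
have [H [sH HH eH]] := householder vv.
pose A' : 'M[R]_(1 + n) := H *m A *m H.
have sA' : A'^T = A' by rewrite /A' !trmx_mul sH sA mulmxA.
have rA' : row 0 A' = a *: delta_mx 0 0.
  rewrite rowE /A' !mulmxA eH vA -scalemxAl; congr (_ *: _).
  by rewrite -eH -mulmxA HH mulmx1.
pose A2 := drsubmx A'.
have A'E : A' = block_mx a%:M 0 0 A2 by exact: symmetric_block sA' rA'.
have sA2 : A2^T = A2 by rewrite /A2 trmx_drsub sA'.
have [U2 [lam2 [oU2 A2E]]] := IH _ sA2.
pose W : 'M[R]_(1 + n) := block_mx 1%:M 0 0 U2.
have WE : A' = W *m diag_mx (row_mx a%:M lam2) *m W^T.
  rewrite /W tr_block_mx !trmx0 trmx1 diag_mx_row !mulmx_block.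
  rewrite !(mulmx0, mul0mx, addr0, add0r, mul1mx, mulmx1) -A2E A'E.
  by congr block_mx; apply/matrixP => i j; rewrite !ord1 !mxE eqxx.
have oW : W^T *m W = 1%:M.
  rewrite /W tr_block_mx !trmx0 trmx1 mulmx_block.
  by rewrite !(mulmx0, mul0mx, addr0, add0r, mul1mx) oU2 -scalar_mx_block.
exists (H *m W), (row_mx a%:M lam2); split.
  by rewrite /orthogonal_mx trmx_mul sH -mulmxA [H *m _]mulmxA HH mul1mx.
rewrite trmx_mul sH !mulmxA.
have -> : H *m W *m diag_mx (row_mx a%:M lam2) *m W^T *m H = H *m A' *m H.
  by rewrite WE !mulmxA.
by rewrite /A' !mulmxA HH mul1mx -mulmxA HH mulmx1.
Qed.

End MatrixFunctionTheory.

(* Main.v *)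
Require Import Defs.
From mathcomp Require Import all_boot all_order all_algebra.
From mathcomp Require Import ring lra.
From mathcomp Require Import all_classical all_reals all_analysis.

(** The probing approximation differs from the trace by the sum of the
off-diagonal entries of [F = - A log A] over the pairs [i != j] of equal color.
As [d >= 1], such a pair is not an edge of the graph, so [A i j = 0]; it is
enough that [F i j <= 0] whenever [i != j] and [A i j = 0].

Write [A = t (I - C)].  The splitting [A = theta I - B] only bounds the
eigenvalues of [B] from above, but [B] may be shifted by any nonnegative
multiple of the identity and stays entrywise nonnegative.  With
[t = theta + tr A] the shifted and scaled matrix [C = I - A / t] has its
spectrum in [[0, 1]].  Since
[- A log A = - (log t) A + t (- (I - C) log (I - C))], the sign of [F i j] is
that of the second term.

On [[0, 1]] the function [- (1 - x) log (1 - x)] is the pointwise limit of the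
polynomials [(1 - x) (x + x^2 / 2 + ... + x^m / m)] ([cvg_neg_xlogx1m]); the
factor [1 - x] takes care of the eigenvalue [x = 1], where the logarithmic
series diverges.  Applied to [C], these polynomials give the sums of
[(a_k - a_(k+1)) / (k+1)] for [k < m], where [a_k] is the entry of [C^(k+1)] at
[(i, j)].  All the [a_k] are nonnegative and the weights decrease, so summation
by parts bounds every such sum by [a_0 = C i j = 0]
([weighted_telescope_le]), and the bound passes to the limit. *)

Set Implicit Arguments.
Unset Strict Implicit.

Import Order.TTheory GRing.Theory Num.Theory.
Import numFieldNormedType.Exports.
Local Open Scope ring_scope.

(** * The logarithmic series *)

(** A truncation of the power series of [- ln (1 - x)]. *)
Definition logsum (R : realType) (m : nat) (x : R) : R :=
  \sum_(k < m) x ^+ k.+1 / k.+1%:R.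

(** Differentiation turns the partial sum into a finite geometric series, and the
remainder [x ^+ m / (1 - x)] is what that series lacks to reach [(1 - x)^-1]. *)
Lemma is_derive_ln_logsum (R : realType) (m : nat) (x : R) : x < 1 ->
  is_derive x 1 (fun y => ln (1 - y) + logsum m y) (- (x ^+ m / (1 - x))).
Proof.
move=> x1; have x1' : 0 < 1 - x by rewrite subr_gt0.
elim: m => [|m IH].
  have dln : is_derive (1 - x) 1 (@ln R) (1 - x)^-1 by exact: is_derive1_ln.
  have -> : (fun y => ln (1 - y) + logsum 0 y) = @ln R \o (cst 1 - id).
    by apply/funext => y; rewrite /logsum big_ord0 addr0.
  apply: is_derive_eq.
  by rewrite expr0 mul1r sub0r mulrN1.
have -> : (fun y => ln (1 - y) + logsum m.+1 y) =
    (fun y => ln (1 - y) + logsum m y) + m.+1%:R^-1 *: (id ^+ m.+1 : R -> R).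
  apply/funext => y; rewrite /logsum big_ord_recr /= addrA.
  by rewrite -[RHS]/(_ + _ * _) exprfctE mulrC.
apply: is_derive_eq.
rewrite /= -[_ *: _]/(_ * (_ * 1)) mulr1 mulrA mulVf ?pnatr_eq0// mul1r.
by rewrite exprS; field; rewrite gt_eqF.
Qed.

(** By the mean value theorem the remainder is [x * (y ^+ m / (1 - y))] for some
[y] in [[0, x]], and this increases with [y].  The denominator [1 - x] is
harmless, as it cancels after multiplication by [1 - x]. *)
Lemma ln_logsum_bound (R : realType) (m : nat) (x : R) : 0 <= x < 1 ->
  0 <= - ln (1 - x) - logsum m x <= x ^+ m.+1 / (1 - x).
Proof.
move=> /andP[x0 x1].
have der y : y \in `[0, x]%R ->
    is_derive y 1 (fun y => ln (1 - y) + logsum m y) (- (y ^+ m / (1 - y))).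
  rewrite in_itv /= => /andP[_ yx]; apply: is_derive_ln_logsum.
  exact: le_lt_trans x1.
have derc : {within `[0, x], continuous (fun y => ln (1 - y) + logsum m y)}%classic.
  by apply: derivable_within_continuous => y /der [].
have [y] := MVT_segment x0 (fun y yi => der y (subset_itv_oo_cc yi)) derc.
rewrite in_itv /= => /andP[y0 yx].
rewrite !subr0 ln1 [logsum m (0 : R)]big1 ?addr0 ?subr0; last first.
  by move=> k _; rewrite expr0n mul0r.
rewrite -opprD => ->; rewrite mulNr opprK.
have x1' : 0 < 1 - x by rewrite subr_gt0.
have y1 : 0 < 1 - y by rewrite subr_gt0 (le_lt_trans yx).
rewrite mulr_ge0 ?divr_ge0 ?exprn_ge0 ?(ltW y1)//=.
rewrite exprSr [leRHS]mulrAC; apply: ler_wpM2r => //.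
apply: ler_pM; rewrite ?exprn_ge0 ?invr_ge0 ?(ltW y1)//.
  exact: lerXn2r.
by rewrite lef_pV2 ?posrE// lerB.
Qed.

Lemma cvg_neg_xlogx1m (R : realType) (x : R) : 0 <= x <= 1 ->
  ((1 - x) * logsum m x @[m --> \oo] --> neg_xlogx (1 - x))%classic.
Proof.
case/andP=> x0; rewrite le_eqVlt => /predU1P[->|x1].
  rewrite /neg_xlogx subrr mul0r oppr0.
  under eq_fun do rewrite mul0r.
  exact: cvg_cst.
have x1' : 0 < 1 - x by rewrite subr_gt0.
apply: (@squeeze_cvgr _ _ _ _ (fun m => neg_xlogx (1 - x) - x ^+ m.+1)
                              (fun=> neg_xlogx (1 - x))); last exact: cvg_cst.
- apply: nearW => m.
  have /andP[] : 0 <= - ln (1 - x) - logsum m x <= x ^+ m.+1 / (1 - x).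
    by apply: ln_logsum_bound; rewrite x0.
  rewrite ler_pdivlMr // /neg_xlogx => h1 h2.
  have {}h1 := mulr_ge0 (ltW x1') h1; nra.
- rewrite -[X in (_ --> X)%classic]subr0; apply: cvgB; first exact: cvg_cst.
  rewrite (cvg_shiftS (fun m => x ^+ m)); apply: cvg_expr.
  by rewrite ger0_norm.
Qed.

Lemma weighted_telescope_le (R : realType) (a : nat -> R) (m : nat) :
  (forall k, 0 <= a k) ->
  \sum_(k < m) (a k - a k.+1) / k.+1%:R <= a 0%N.
Proof.
move=> a0.
(* Summation by parts leaves the boundary term [a m / m.+1], which makes the
   induction go through. *)
suff h : \sum_(k < m) (a k - a k.+1) / k.+1%:R + a m / m.+1%:R <= a 0%N.
  by apply: le_trans h; rewrite lerDl divr_ge0.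
elim: m => [|m IH]; first by rewrite big_ord0 add0r divr1.
rewrite big_ord_recr /=; apply: le_trans IH.
rewrite -addrA lerD2l mulrBl -addrA gerDl addrC subr_le0.
by rewrite ler_wpM2l // lef_pV2 ?posrE// ler_nat.
Qed.

(** * Functions of symmetric matrices *)

Lemma matfun_entry (R : realType) n (f : R -> R) (A U : 'M[R]_n) lam i j :
  spectral_decomposition A U lam ->
  matfun f A i j = \sum_k U i k * U j k * f (lam 0 k).
Proof.
move=> /matfunE ->; rewrite mul_mx_diag !mxE.
by apply: eq_bigr => k _; rewrite !mxE mulrAC.
Qed.

Lemma matfun_id (R : realType) n (A U : 'M[R]_n) lam :
  spectral_decomposition A U lam -> matfun id A = A.
Proof. by move=> AU; rewrite (matfunE _ AU) map_mx_id // -AU.2. Qed.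

(** The matrix function of [x ^+ m] is the [m]-th power of [C], and products of
nonnegative matrices are nonnegative. *)
Lemma matfun_expr_ge0 (R : realType) n (C U : 'M[R]_n) lam m :
  spectral_decomposition C U lam -> (forall i j, 0 <= C i j) ->
  forall i j, 0 <= matfun (fun x => x ^+ m) C i j.
Proof.
move=> CU C0; elim: m => [|m IH] i j; rewrite (matfunE _ CU).
  have -> : map_mx (fun x => x ^+ 0) lam = const_mx 1.
    by apply/rowP => k; rewrite !mxE expr0.
  by rewrite diag_const_mx mulmx1 (mulmx1C CU.1) !mxE ler0n.
have -> : U *m diag_mx (map_mx (fun x => x ^+ m.+1) lam) *m U^T =
    C *m matfun (fun x => x ^+ m) C.
  rewrite (matfunE _ CU) {1}CU.2 !mulmxA -[_ *m U^T *m U]mulmxA CU.1 mulmx1.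
  rewrite -[U *m _ *m diag_mx _]mulmxA; congr (_ *m _ *m _).
  rewrite mulmx_diag; congr diag_mx; apply/rowP => k.
  by rewrite !mxE exprS.
by rewrite mxE sumr_ge0 // => k _; rewrite mulr_ge0.
Qed.

(** The entries of a matrix function depend on finitely many values of the
function, so pointwise convergence on the spectrum is enough to pass from the
polynomials [(1 - x) * logsum m x] to their limit. *)
Lemma matfun_neg_xlogx1m_le0 (R : realType) n (C U : 'M[R]_n) lam i j :
  spectral_decomposition C U lam -> (forall k, 0 <= lam 0 k <= 1) ->
  (forall k l, 0 <= C k l) -> C i j = 0 ->
  matfun (fun x => neg_xlogx (1 - x)) C i j <= 0.
Proof.
move=> CU lam01 C0 Cij; rewrite (matfun_entry _ _ _ CU).
pose s m := \sum_k U i k * U j k * ((1 - lam 0 k) * logsum m (lam 0 k)).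
apply: (@cvgr_to_le _ \oo%classic _ _ s).
  apply: (@cvg_big R _ +%R 0 xpredT add_continuous).
  by move=> k _; apply: cvgMl_tmp; exact: cvg_neg_xlogx1m.
apply: nearW => m.
pose a k := matfun (fun x => x ^+ k.+1) C i j.
have <- : \sum_(k < m) (a k - a k.+1) / k.+1%:R = s m.
  under eq_bigr do rewrite /a !(matfun_entry _ _ _ CU) -sumrB mulr_suml.
  rewrite exchange_big /=; apply: eq_bigr => k _.
  rewrite /logsum !mulr_sumr; apply: eq_bigr => p _.
  by rewrite [_ ^+ p.+2]exprS; ring.
have a0 : a 0%N = 0 by rewrite -Cij -[in RHS](matfun_id CU) /a !(matfun_entry _ _ _ CU).
by rewrite -[leRHS]a0; apply: weighted_telescope_le => k; exact: matfun_expr_ge0 CU C0 _ _.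
Qed.

(** * Symmetric M-matrices *)

Lemma neg_xlogxM (R : realType) (t y : R) : 0 < t -> 0 <= y ->
  neg_xlogx (t * y) = - ln t * (t * y) + t * neg_xlogx y.
Proof.
move=> t0; rewrite le_eqVlt => /predU1P[<-|y0].
  by rewrite /neg_xlogx !(mulr0, mul0r, oppr0) addr0.
by rewrite /neg_xlogx lnM ?posrE//; ring.
Qed.

Lemma spectral_decomposition_affine (R : realType) n (A U : 'M[R]_n) lam a b :
  spectral_decomposition A U lam ->
  spectral_decomposition (a%:M + b *: A) U (const_mx a + b *: lam).
Proof.
move=> [oU AU]; split=> //.
rewrite linearD linearZ /= diag_const_mx mulmxDr mulmxDl.
rewrite mul_mx_scalar -scalemxAl (mulmx1C oU) scalemx1.
by rewrite -scalemxAr -scalemxAl -AU.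
Qed.

Lemma spectral_decomposition_eigenvalue (R : realType) n (A U : 'M[R]_n) lam k :
  spectral_decomposition A U lam -> eigenvalue A (lam 0 k).
Proof.
move=> [oU AU]; apply/eigenvalueP; exists (row k U^T).
  rewrite -row_mul [in LHS]AU !mulmxA oU mul1mx row_mul row_diag_mx.
  by rewrite -scalemxAl -rowE.
apply/eqP => Uk0; have /(congr1 (row k)) := oU.
rewrite row_mul Uk0 mul0mx => /rowP/(_ k) /eqP.
by rewrite !mxE eqxx eq_sym oner_eq0.
Qed.

(** Reduction to [matfun_neg_xlogx1m_le0] for [C = I - A / t], [t] being large
enough for the spectrum of [C] to lie in [[0, 1]]. *)
Lemma Mmatrix_neg_xlogx_le0 (R : realType) n (A : 'M[R]_n) i j :
  symmetric_Mmatrix A -> A i j = 0 -> i != j ->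
  matfun (@neg_xlogx R) A i j <= 0.
Proof.
move=> [sA [theta [B [theta0 B0 Btheta AB]]]] Aij ij.
have [U [lam AU]] := spectral_theorem sA.
have lam0 k : 0 <= lam 0 k.
  have BU := spectral_decomposition_affine theta (-1) AU.
  have := spectral_decomposition_eigenvalue k BU.
  rewrite scaleN1r AB opprB addrC subrK => /Btheta.
  by rewrite !mxE; lra.
(* The eigenvalues being nonnegative, their sum bounds each of them. *)
pose t := theta + \sum_k lam 0 k.
have t_ge k : lam 0 k <= t.
  rewrite /t (bigD1 k) //= addrCA lerDl addr_ge0 ?(ltW theta0)//.
  by apply: sumr_ge0.
have theta_le : theta <= t by rewrite lerDl sumr_ge0.
have t0 : 0 < t by exact: lt_le_trans theta_le.
have CU := spectral_decomposition_affine 1 (- t^-1) AU.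
set C := _ + _ in CU; set c := _ + _ in CU.
have cE k : c 0 k = 1 - lam 0 k / t by rewrite !mxE mulNr mulrC.
have -> : matfun (@neg_xlogx R) A i j =
    - ln t * A i j + t * matfun (fun x => neg_xlogx (1 - x)) C i j.
  rewrite -[in - ln t * _](matfun_id AU).
  rewrite !(matfun_entry _ _ _ AU) (matfun_entry _ _ _ CU) !mulr_sumr -big_split /=.
  apply: eq_bigr => k _; rewrite cE subKr.
  have {1}-> : lam 0 k = t * (lam 0 k / t) by rewrite mulrCA divff ?mulr1 ?gt_eqF.
  rewrite neg_xlogxM ?divr_ge0 ?(ltW t0)//.
  by field; rewrite gt_eqF.
rewrite Aij mulr0 add0r pmulr_rle0 //.
apply: (matfun_neg_xlogx1m_le0 CU) => [k|k l|].
- by rewrite cE subr_ge0 gerBl divr_ge0 ?(ltW t0)// ler_pdivrMr // mul1r t_ge.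
(* [C] is [B], shifted by [t - theta >= 0] on the diagonal and divided by [t]. *)
- have -> : C k l = ((t - theta) * (k == l)%:R + B k l) / t.
    rewrite /C AB !mxE; case: (k == l) => /=; rewrite ?mulr1n ?mulr0n;
    by field; rewrite gt_eqF.
  by rewrite divr_ge0 ?(ltW t0)// addr_ge0 // mulr_ge0 // subr_ge0.
- by rewrite !mxE Aij mulr0 addr0 (negbTE ij).
Qed.

(** * Probing *)

(** A nonzero entry [A i j] makes [[:: j]] a walk of length one. *)
Lemma distance_coloring_eq0 (R : realType) n (A : 'M[R]_n) d P (V : {set 'I_n}) i j :
  (1 <= d)%N -> distance_coloring A d P ->
  V \in P -> i \in V -> j \in V -> i != j -> A i j = 0.
Proof.
move=> d1 [colP distP] VP iV jV ij; apply/eqP/negPn/negP => Aij.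
have /and3P[_ tP _] := colP.
have /eqP[] : finset.pblock P i != finset.pblock P j; last first.
  by rewrite !(finset.def_pblock tP VP).
apply: distP => //; apply: ge_ereal_inf; exists 1%:E; last by rewrite lee_fin ler1n.
by exists [:: j] => //=; rewrite /is_walk /= /mxedge ij Aij eqxx.
Qed.

Lemma probing_quadratic_form (R : realType) n (V : {set 'I_n}) (F : 'M[R]_n) :
  ((probing_vector R V)^T *m F *m probing_vector R V) 0 0 =
  \sum_(i in V) \sum_(j in V) F i j.
Proof.
have vE k : probing_vector R V k 0 = (k \in V)%:R.
  rewrite /probing_vector summxE; under eq_bigr do rewrite mxE eqxx andbT.
  have [kV|kV] := boolP (k \in V).
    by rewrite (bigD1 k) //= eqxx big1 ?addr0 // => i /andP[_]; rewrite eq_sym => /negbTE->.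
  by rewrite big1 // => i iV; case: eqP kV iV => // -> /negbTE->.
rewrite -mulmxA mxE [RHS]big_mkcond; apply: eq_bigr => i _.
rewrite mxE vE; case: (i \in V); rewrite ?mul0r // mul1r.
rewrite mxE [RHS]big_mkcond; apply: eq_bigr => j _.
by rewrite vE; case: (j \in V); rewrite ?mulr0 ?mulr1.
Qed.

Theorem proposition3p6 (R : realType) (n : nat) (A : 'M[R]_n) (d : nat)
    (P : {set {set 'I_n}}) :
  symmetric_Mmatrix A -> (1 <= d)%N -> distance_coloring A d P ->
  probing_trace P (matfun (@neg_xlogx R) A) <= entropy A.
Proof.
move=> MA d1 colP; rewrite /entropy; set F := matfun _ _.
have -> : \tr F = \sum_(V in P) \sum_(i in V) F i i.
  rewrite -(finset.set_partition_big _ colP.1).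
  by apply: eq_bigl => i; rewrite inE.
apply: ler_sum => V VP; rewrite probing_quadratic_form.
apply: ler_sum => i iV; rewrite (bigD1 i) //= gerDl.
apply: sumr_le0 => j /andP[jV ji]; rewrite eq_sym in ji.
apply: Mmatrix_neg_xlogx_le0 => //.
exact: distance_coloring_eq0 d1 colP VP iV jV ji.
Qed.
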